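(* Let $R$ be any (associative unital) ring. The class of Gorenstein AC-flat $R$-modules is precovering.
   Context: $R$-module means left $R$-module. $\mathrm{FP}_\infty$ is the class of modules having a resolution by finitely generated projective modules. A right $R$-module $A$ is absolutely clean if $\mathrm{Ext}^1_R(F,A)=0$ for all right $R$-modules $F\in\mathrm{FP}_\infty$. An $R$-module $M$ is Gorenstein AC-flat if there is an exact complex of flat modules $\mathbf F=\cdots\to F_1\to F_0\to F_{-1}\to\cdots$ such that $A\otimes_R\mathbf F$ is exact for every absolutely clean right $R$-module $A$ and $M$ is one of the cycles of $\mathbf F$. A class $\mathcal X$ of modules is precovering if for every module $M$ there is a map $\varphi\colon X\to M$ with $X\in\mathcal X$ such that every map $X'\to M$ with $X'\in\mathcal X$ factors through $\varphi$. *)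

(* Defs.v *)
From HB Require Import structures.
From mathcomp Require Import all_boot all_algebra.
From mathcomp Require Import generic_quotient ring_quotient boolp.
From mathcomp Require Import freeg.

Set Implicit Arguments.
Unset Strict Implicit.
Unset Printing Implicit Defensive.

Import GRing.Theory.
Local Open Scope ring_scope.
Local Open Scope quotient_scope.

(* A left R-module is an lmodType R. A right R-module is an lmodType R^c, where
   R^c is the opposite ring; a right action a.r is written (r : R^c) *: a. Rings
   are pzRingType's, so the zero ring is allowed. *)

Definition exact_at (U V W : zmodType) (f : U -> V) (g : V -> W) : Prop :=
  forall v, g v = 0 <-> exists u, f u = v.

Section TensorProduct.
Variables (R : pzRingType) (A : lmodType R^c) (M : lmodType R).

Definition tgen (a : A) (m : M) : {freeg (A * M)%type} := << (a, m) >>.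

(* The subgroup generated by the defining relations of the tensor product. *)
Inductive tensor_rel : {freeg (A * M)%type} -> Prop :=
| tensor_rel0 : tensor_rel 0
| tensor_relB x y : tensor_rel x -> tensor_rel y -> tensor_rel (x - y)
| tensor_relDl a a' m : tensor_rel (tgen (a + a') m - (tgen a m + tgen a' m))
| tensor_relDr a m m' : tensor_rel (tgen a (m + m') - (tgen a m + tgen a m'))
| tensor_rel_bal a (r : R) m :
    tensor_rel (tgen ((r : R^c) *: a) m - tgen a (r *: m)).

Definition tensor_ker : {pred {freeg (A * M)%type}} :=
  fun x => `[< tensor_rel x >].

Fact tensor_ker_zmod : zmod_closed tensor_ker.
Proof.
split=> [|x y]; rewrite -!topredE /=; first by apply/asboolP/tensor_rel0.
by move=> /asboolP hx /asboolP hy; apply/asboolP/tensor_relB.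
Qed.

HB.instance Definition _ :=
  GRing.isZmodClosed.Build {freeg (A * M)%type} tensor_ker tensor_ker_zmod.

Definition tensor : zmodType := Quotient.quot tensor_ker.

Definition tensor_proj (x : {freeg (A * M)%type}) : tensor :=
  \pi_(Quotient.quot tensor_ker) x.

Definition tmul (a : A) (m : M) : tensor := tensor_proj (tgen a m).

End TensorProduct.

Section TensorMap.
Variables (R : pzRingType) (A B : lmodType R^c) (M N : lmodType R).
Variables (f : {linear A -> B}) (g : {linear M -> N}).

Definition freeg_map : {freeg (A * M)%type} -> {freeg (B * N)%type} :=
  fglift (fun p => tgen (f p.1) (g p.2)).

(* Computed on a representative; tensor_map_proj shows that the choice does not
   matter. *)
Definition tensor_map (x : tensor A M) : tensor B N :=
  tensor_proj (freeg_map (repr x)).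

Fact freeg_map_tgen a m : freeg_map (tgen a m) = tgen (f a) (g m).
Proof. by rewrite /freeg_map liftU scale1r. Qed.

Fact freeg_mapB x y : freeg_map (x - y) = freeg_map x - freeg_map y.
Proof. exact: lift_is_additive. Qed.

Fact freeg_map_rel x : tensor_rel x -> tensor_rel (freeg_map x).
Proof.
have map0 : freeg_map 0 = 0 by rewrite -(subrr 0) freeg_mapB subrr.
have mapD u v : freeg_map (u + v) = freeg_map u + freeg_map v.
  by rewrite -[v in LHS]opprK -[- v]add0r !freeg_mapB map0 sub0r opprK.
elim=> [|u v _ hu _ hv|a a' m|a m m'|a r m].
- by rewrite map0; exact: tensor_rel0.
- by rewrite freeg_mapB; exact: tensor_relB.
- by rewrite freeg_mapB mapD !freeg_map_tgen linearD; exact: tensor_relDl.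
- by rewrite freeg_mapB mapD !freeg_map_tgen linearD; exact: tensor_relDr.
- by rewrite freeg_mapB !freeg_map_tgen !linearZ; exact: tensor_rel_bal.
Qed.

Lemma tensor_map_proj x : tensor_map (tensor_proj x) = tensor_proj (freeg_map x).
Proof.
apply/eqP; rewrite /tensor_map /tensor_proj -Quotient.idealrBE -freeg_mapB.
rewrite -topredE /=; apply/asboolP/freeg_map_rel/asboolP.
have /eqP : repr (\pi_(Quotient.quot (tensor_ker (A:=A) (M:=M))) x) = x
   %[mod Quotient.quot (tensor_ker (A:=A) (M:=M))] by rewrite reprK.
by rewrite -Quotient.idealrBE -topredE.
Qed.

Lemma tensor_map_tmul a m : tensor_map (tmul a m) = tmul (f a) (g m).
Proof. by rewrite tensor_map_proj freeg_map_tgen. Qed.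

Fact tensor_map_zmod_morphism : zmod_morphism tensor_map.
Proof.
move=> x y; rewrite -[x]reprK -[y]reprK -raddfB.
by rewrite !tensor_map_proj freeg_mapB [LHS]raddfB.
Qed.

HB.instance Definition _ :=
  GRing.isZmodMorphism.Build (tensor A M) (tensor B N) tensor_map
    tensor_map_zmod_morphism.

End TensorMap.

Section Modules.
Variable R : pzRingType.

Definition flat (M : lmodType R) : Prop :=
  forall (A B C : lmodType R^c) (f : {linear A -> B}) (g : {linear B -> C}),
    exact_at f g ->
    exact_at (tensor_map f (idfun : {linear M -> M}))
             (tensor_map g (idfun : {linear M -> M})).

Definition projective (P : lmodType R) : Prop :=
  forall (X Y : lmodType R) (p : {linear X -> Y}) (f : {linear P -> Y}),
    (forall y, exists x, p x = y) ->
    exists h : {linear P -> X}, forall u, p (h u) = f u.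

Definition finitely_generated (M : lmodType R) : Prop :=
  exists (n : nat) (e : 'I_n -> M),
    forall x, exists c : 'I_n -> R, x = \sum_(i < n) c i *: e i.

(* ... -> res_mod 1 -> res_mod 0 -> M -> 0 *)
Record resolution (M : lmodType R) := Resolution {
  res_mod : nat -> lmodType R;
  res_diff : forall n, {linear res_mod n.+1 -> res_mod n};
  res_aug : {linear res_mod 0%N -> M};
  res_exact : forall n, exact_at (res_diff n.+1) (res_diff n);
  res_exact_aug : exact_at (res_diff 0%N) res_aug;
  res_aug_surj : forall x, exists u, res_aug u = x
}.

Definition FPinfty (M : lmodType R) : Prop :=
  exists P : resolution M,
    forall n, projective (res_mod P n) /\ finitely_generated (res_mod P n).

(* Ext^1(F, A) = 0, where Ext^1(F, A) is the cohomology in degree 1 of the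
   complex Hom(P, A), for a projective resolution P of F. *)
Definition Ext1_eq0 (F A : lmodType R) : Prop :=
  forall P : resolution F, (forall n, projective (res_mod P n)) ->
  forall f : {linear res_mod P 1%N -> A},
    (forall u, f (res_diff P 1%N u) = 0) ->
    exists g : {linear res_mod P 0%N -> A},
      forall u, f u = g (res_diff P 0%N u).

Definition absolutely_clean (A : lmodType R) : Prop :=
  forall F : lmodType R, FPinfty F -> Ext1_eq0 F A.

Definition precovering (X : lmodType R -> Prop) : Prop :=
  forall M : lmodType R, exists (C : lmodType R) (phi : {linear C -> M}),
    X C /\
    forall (C' : lmodType R) (psi : {linear C' -> M}), X C' ->
      exists h : {linear C' -> C}, forall u, phi (h u) = psi u.

End Modules.

(* M is a cycle of F when it is isomorphic to the kernel of some differential,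
   i.e. when some injective linear map i : M -> F (n + 1) has image
   ker (d n : F (n + 1) -> F n). *)
Definition Gorenstein_AC_flat (R : pzRingType) (M : lmodType R) : Prop :=
  exists (F : int -> lmodType R) (d : forall n : int, {linear F (n + 1) -> F n}),
    [/\ forall n, flat (F n),
        forall n, exact_at (d (n + 1)) (d n),
        forall A : lmodType R^c, absolutely_clean A ->
          forall n, exact_at (tensor_map (idfun : {linear A -> A}) (d (n + 1)))
                             (tensor_map (idfun : {linear A -> A}) (d n)) &
        exists (n : int) (i : {linear M -> F (n + 1)}),
          injective i /\ exact_at i (d n)].

(* Main.v *)
Require Import Defs.
From Stdlib Require List.
From HB Require Import structures.
From mathcomp Require Import all_boot all_algebra.
From mathcomp Require Import generic_quotient ring_quotient boolp classical_sets.
From mathcomp Require Import freeg.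

(** Call a complex F of flat modules AC-acyclic when it is exact and stays exact
    after tensoring with every absolutely clean right module.  The functor
    sending F to the cokernel of F_3 -> F_2 is left adjoint to the functor
    sending M to the complex with M alone in degree 2, and when F is exact this
    cokernel is a cycle of F.  So a precover of M is obtained by taking the
    cokernel of an AC-acyclic complex S with a map S_2 -> M killing boundaries,
    through which all such maps factor.  As AC-acyclic complexes are closed under
    direct sums ([AC_acyclic_dsum]), S can be a direct sum, provided that every
    map F_2 -> M of this kind factors through some member of a family of
    AC-acyclic complexes indexed by a type that depends on R and M alone.

    The factorization is through a pure quotient of F.  Purity is used in the
    form: every finite set of linear relations between elements of the quotient
    F/P can be lifted to F.  Vanishing of an element of a tensor product is
    witnessed by finitely many relations, hence AC-acyclicity passes to pure
    quotients ([AC_acyclic_pure_quotient]).  Unions of chains of pure subcomplexes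
    are pure, so Zorn's lemma gives a pure P maximal among those on which F_2 -> M
    vanishes ([pure_maximal]).  The quotient Q = F/P is then bounded in size.
    Fix a type T of Skolem terms; they name elements of a complex, in such a way
    that the set D of the named elements of Q realizes, over any bounded set of
    its own elements, every type of bounded arity realized in Q ([saturation]).
    If D is not all of Q, choose a small relatively pure subcomplex N of Q that is
    not contained in D; saturation gives a copy of N inside D, by a map theta over
    M that is the identity on the intersection of N and D.  The elements
    n - theta(n) form a nonzero pure subcomplex of Q on which the map to M
    vanishes ([pure_in_ker]), against the maximality of P.

    So Q is named by T, and it is determined up to isomorphism by the relations
    that hold between the terms.  These sets of relations form the index type of
    the direct sum. *)

Set Implicit Arguments.
Unset Strict Implicit.
Unset Printing Implicit Defensive.

Import GRing.Theory.
Local Open Scope ring_scope.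
Local Open Scope quotient_scope.

(** * Linear maps, quotients and direct sums of modules *)

Section LinearMaps.
Variable R : pzRingType.
Implicit Types U V W : lmodType R.

(** A relation that is total, compatible with linear combinations and
    single-valued at 0 is the graph of a linear map; the two factorization lemmas
    below are the instances that define maps out of a quotient and maps into a
    submodule. *)
Lemma linear_graph U V (G : U -> V -> Prop) :
    (forall x, exists y, G x y) ->
    (forall a x x' y y', G x y -> G x' y' -> G (a *: x + x') (a *: y + y')) ->
    (forall y, G 0 y -> y = 0) ->
  exists g : {linear U -> V}, forall x, G x (g x).
Proof.
move=> tot lin fun0.
pose g x := projT1 (cid (tot x)).
have gP x : G x (g x) by rewrite /g; case: cid.
have uniq x y y' : G x y -> G x y' -> y = y'.
  move=> xy xy'; have := lin (-1) _ _ _ _ xy xy'.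
  by rewrite !scaleN1r addNr => /fun0/eqP; rewrite addrC subr_eq0 => /eqP.
have glin : linear g by move=> a x y; exact: (uniq _ _ _ (gP _) (lin _ _ _ _ _ _ _)).
pose gL := GRing.isLinear.Build R U V *:%R g glin.
by exists (HB.pack_for {linear U -> V} g gL).
Qed.

Lemma linear_factor_surj U V W (e : {linear U -> W}) (f : {linear U -> V}) :
    (forall w, exists u, e u = w) -> (forall u, e u = 0 -> f u = 0) ->
  exists g : {linear W -> V}, forall u, g (e u) = f u.
Proof.
move=> e_surj kerS.
have [||_ [u /eqP e0 <-]|g gP] :=
    @linear_graph W V (fun w y => exists2 u, e u = w & f u = y).
- by move=> w; have [u <-] := e_surj w; exists (f u), u.
- move=> a w w' y y' [u <- <-] [u' <- <-].
  by exists (a *: u + u'); rewrite linearP.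
- by apply: kerS; exact/eqP.
exists g => u; have [u' euu' <-] := gP (e u).
by apply/eqP; rewrite eq_sym -subr_eq0 -linearB kerS // linearB euu' subrr.
Qed.

Lemma linear_factor_inj U V W (i : {linear W -> V}) (f : {linear U -> V}) :
    injective i -> (forall u, exists w, i w = f u) ->
  exists g : {linear U -> W}, forall u, i (g u) = f u.
Proof.
move=> i_inj f_im.
have [//||w|g gP] := @linear_graph U W (fun u w => i w = f u).
- by move=> a u u' w w' wu wu'; rewrite !linearP wu wu'.
- by rewrite linear0 -(linear0 i) => /i_inj.
by exists g.
Qed.

End LinearMaps.

Record submod (R : pzRingType) (U : lmodType R) := Submod {
  smem :> U -> Prop;
  smem0 : smem 0;
  smemP : forall a x y, smem x -> smem y -> smem (a *: x + y)
}.

Section QuotientModule.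
Variables (R : pzRingType) (U : lmodType R) (S : submod U).

Lemma smemD x y : S x -> S y -> S (x + y).
Proof. by move=> ? ?; rewrite -[x]scale1r; apply: smemP. Qed.
Lemma smemZ a x : S x -> S (a *: x).
Proof. by move=> ?; rewrite -[_ *: x]addr0; apply: smemP => //; exact: smem0. Qed.
Lemma smemN x : S x -> S (- x).
Proof. by rewrite -scaleN1r; exact: smemZ. Qed.
Lemma smemB x y : S x -> S y -> S (x - y).
Proof. by move=> ? ?; apply/smemD/smemN. Qed.

Definition quot_ker : {pred U} := fun x => `[< S x >].

Fact quot_ker_zmod : zmod_closed quot_ker.
Proof.
split=> [|x y]; rewrite -!topredE /=; first exact/asboolP/smem0.
by move=> /asboolP ? /asboolP ?; exact/asboolP/smemB.
Qed.

HB.instance Definition _ :=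
  GRing.isZmodClosed.Build U quot_ker quot_ker_zmod.

Definition quot_carrier : zmodType := Quotient.quot quot_ker.
Definition quot_pi (x : U) : quot_carrier := \pi_(Quotient.quot quot_ker) x.

Lemma quot_piP x y : quot_pi x = quot_pi y <-> S (x - y).
Proof.
rewrite /quot_pi; split=> [/eqP|Sxy].
  by rewrite -Quotient.idealrBE -topredE /= => /asboolP.
by apply/eqP; rewrite -Quotient.idealrBE -topredE /=; exact/asboolP.
Qed.

Lemma quot_piD x y : quot_pi (x + y) = quot_pi x + quot_pi y.
Proof. exact: raddfD. Qed.

Lemma quot_pi_surj q : exists x, quot_pi x = q.
Proof. by exists (repr q); exact: reprK. Qed.

Definition quot_scale (a : R) (q : quot_carrier) : quot_carrier :=
  quot_pi (a *: repr q).

Lemma quot_scaleE a x : quot_scale a (quot_pi x) = quot_pi (a *: x).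
Proof.
apply/quot_piP; rewrite -scalerBr; apply: smemZ.
by apply/quot_piP; exact: reprK.
Qed.

Fact quot_scaleA a b q : quot_scale a (quot_scale b q) = quot_scale (a * b) q.
Proof. by have [x <-] := quot_pi_surj q; rewrite !quot_scaleE scalerA. Qed.
Fact quot_scale1 : left_id 1 quot_scale.
Proof. by move=> q; have [x <-] := quot_pi_surj q; rewrite quot_scaleE scale1r. Qed.
Fact quot_scaleDr : right_distributive quot_scale +%R.
Proof.
move=> a p q; have [[x <-] [y <-]] := (quot_pi_surj p, quot_pi_surj q).
by rewrite -quot_piD !quot_scaleE scalerDr quot_piD.
Qed.
Fact quot_scaleDl q : {morph quot_scale^~ q : a b / a + b}.
Proof.
move=> a b; have [x <-] := quot_pi_surj q.
by rewrite !quot_scaleE scalerDl quot_piD.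
Qed.

(** A separate constant, so that the module structure is attached to it rather
    than to the generic quotient of abelian groups. *)
Definition quot : Type := quot_carrier.
HB.instance Definition _ := GRing.Zmodule.on quot.
HB.instance Definition _ := GRing.Zmodule_isLmodule.Build R quot
  quot_scaleA quot_scale1 quot_scaleDr quot_scaleDl.

Definition quot_proj (x : U) : quot := quot_pi x.
Fact quot_proj_linear : linear quot_proj.
Proof.
move=> a x y; rewrite /quot_proj quot_piD; congr (_ + _); exact/esym/quot_scaleE.
Qed.
HB.instance Definition _ :=
  GRing.isLinear.Build R U quot *:%R quot_proj quot_proj_linear.

Lemma quot_proj_eq0 x : quot_proj x = 0 <-> S x.
Proof. by rewrite -(linear0 quot_proj) quot_piP subr0. Qed.

Lemma quot_proj_surj q : exists x, quot_proj x = q.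
Proof. exact: quot_pi_surj. Qed.

End QuotientModule.

Section DirectSum.
Variables (R : pzRingType) (I : choiceType) (U : I -> lmodType R).

Definition supported (s : seq I) (x : forall i, U i) :=
  forall i, i \notin s -> x i = 0.

Definition dsum : Type := {x : forall i, U i | `[< exists s, supported s x >]}.
HB.instance Definition _ := Choice.on dsum.

Definition dval (x : dsum) : forall i, U i := val x.

Lemma dsum_ext (x y : dsum) : (forall i, dval x i = dval y i) -> x = y.
Proof. by move=> xy; apply/val_inj/functional_extensionality_dep. Qed.

Definition dmk x (sx : exists s, supported s x) : dsum :=
  exist (fun x => `[< exists s, supported s x >]) x (asboolT sx).

Lemma dval_supported x : exists s, supported s (dval x).
Proof. exact/asboolP/(valP x). Qed.

Fact dzero_supported : exists s, supported s (fun i => 0 : U i).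
Proof. by exists [::]. Qed.

Fact dopp_supported x : exists s, supported s (fun i => - dval x i).
Proof. by have [s sx] := dval_supported x; exists s => i /sx ->; rewrite oppr0. Qed.

Fact dadd_supported x y : exists s, supported s (fun i => dval x i + dval y i).
Proof.
have [[s sx] [t ty]] := (dval_supported x, dval_supported y).
by exists (s ++ t) => i; rewrite mem_cat => /norP[/sx -> /ty ->]; rewrite addr0.
Qed.

Fact dscale_supported a x : exists s, supported s (fun i => a *: dval x i).
Proof. by have [s sx] := dval_supported x; exists s => i /sx ->; rewrite scaler0. Qed.

Definition dzero := dmk dzero_supported.
Definition dopp x := dmk (dopp_supported x).
Definition dadd x y := dmk (dadd_supported x y).
Definition dscale a x := dmk (dscale_supported a x).

Fact daddA : associative dadd.
Proof. by move=> x y z; apply: dsum_ext => i; exact: addrA. Qed.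
Fact daddC : commutative dadd.
Proof. by move=> x y; apply: dsum_ext => i; exact: addrC. Qed.
Fact dadd0 : left_id dzero dadd.
Proof. by move=> x; apply: dsum_ext => i; exact: add0r. Qed.
Fact daddN : left_inverse dzero dopp dadd.
Proof. by move=> x; apply: dsum_ext => i; exact: addNr. Qed.

HB.instance Definition _ := GRing.isZmodule.Build dsum daddA daddC dadd0 daddN.

Fact dscaleA a b x : dscale a (dscale b x) = dscale (a * b) x.
Proof. by apply: dsum_ext => i; exact: scalerA. Qed.
Fact dscale1 : left_id 1 dscale.
Proof. by move=> x; apply: dsum_ext => i; exact: scale1r. Qed.
Fact dscaleDr : right_distributive dscale +%R.
Proof. by move=> a x y; apply: dsum_ext => i; exact: scalerDr. Qed.
Fact dscaleDl x : {morph dscale^~ x : a b / a + b}.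
Proof. by move=> a b; apply: dsum_ext => i; exact: scalerDl. Qed.

HB.instance Definition _ := GRing.Zmodule_isLmodule.Build R dsum
  dscaleA dscale1 dscaleDr dscaleDl.

Definition dproj i (x : dsum) : U i := dval x i.
Fact dproj_linear i : linear (@dproj i). Proof. by []. Qed.
HB.instance Definition _ i :=
  GRing.isLinear.Build R dsum (U i) *:%R (@dproj i) (@dproj_linear i).

Fact dinj_supported i (u : U i) : 
  exists s, supported s (dfwith (fun j => 0 : U j) u).
Proof.
exists [:: i] => j; rewrite inE => /negPf ji.
by rewrite dfwith_out // eq_sym ji.
Qed.
Definition dinj i (u : U i) : dsum := dmk (dinj_supported u).

Lemma dproj_dinj i (u : U i) : dproj i (dinj u) = u.
Proof. exact: dfwith_in. Qed.
Lemma dproj_dinj_neq i j (u : U i) : i != j -> dproj j (dinj u) = 0.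
Proof. exact: dfwith_out. Qed.

Fact dinj_linear i : linear (@dinj i).
Proof.
move=> a x y; apply: dsum_ext => j; rewrite -!/(dproj _ _) linearP /=.
have [<-|ij] := eqVneq i j; first by rewrite !dproj_dinj.
by rewrite !dproj_dinj_neq // scaler0 addr0.
Qed.
HB.instance Definition _ i :=
  GRing.isLinear.Build R (U i) dsum *:%R (@dinj i) (@dinj_linear i).

Lemma dsum_sum x s : uniq s -> supported s (dval x) ->
  x = \sum_(i <- s) dinj (dproj i x).
Proof.
move=> s_uniq sx; apply: dsum_ext => j; rewrite -!/(dproj _ _) linear_sum /=.
have [js|js] := boolP (j \in s); last first.
  rewrite big_seq big1 => [|i i_s]; first exact: sx.
  by rewrite dproj_dinj_neq //; apply: contraNneq js => <-.
rewrite (bigD1_seq j) //= dproj_dinj big1 ?addr0 // => i ij.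
by rewrite dproj_dinj_neq.
Qed.

Lemma supportedS s t x : {subset s <= t} -> supported s x -> supported t x.
Proof. by move=> st sx i it; apply: sx; apply: contra it; exact: st. Qed.

(** The sum over the support of x does not depend on which list enumerates it:
    all large enough duplicate-free lists give the same value. *)
Lemma dsum_lift (V : lmodType R) (f : forall i, {linear U i -> V}) :
  exists g : {linear dsum -> V}, forall i u, g (dinj u) = f i u.
Proof.
pose G (x : dsum) y := exists s0 : seq I, forall s, uniq s -> {subset s0 <= s} ->
  y = \sum_(i <- s) f i (dproj i x).
have [x|a x x' y y' [s sP] [t tP]|y [s sP]|g gP] := @linear_graph R dsum V G.
- have [s sx] := dval_supported x; exists (\sum_(i <- undup s) f i (dproj i x)), s.
  move=> t t_uniq st; rewrite [RHS](bigID [in s]) /= [X in _ + X]big1 ?addr0.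
    rewrite -[RHS]big_filter; apply: perm_big; apply: uniq_perm.
    + exact: undup_uniq.
    + exact: filter_uniq.
    move=> i; rewrite mem_undup mem_filter.
    by have [/st ->|//] := boolP (i \in s).
  by move=> i /sx; rewrite /dproj => ->; rewrite linear0.
- exists (s ++ t) => r r_uniq str.
  rewrite (sP r) ?(tP r) //; last 2 first.
  + by move=> i it; apply: str; rewrite mem_cat it orbT.
  + by move=> i it; apply: str; rewrite mem_cat it.
  rewrite scaler_sumr -big_split; apply: eq_bigr => i _ /=.
  by rewrite !linearP.
- rewrite (sP (undup s)) ?undup_uniq // => [|i]; last by rewrite mem_undup.
  by rewrite big1 // => i _; rewrite !linear0.
exists g => i u; have [s sP] := gP (dinj u).
rewrite (sP (undup (i :: s))) ?undup_uniq // => [|j js]; last first.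
  by rewrite mem_undup inE js orbT.
rewrite (bigD1_seq i) ?undup_uniq ?mem_undup ?mem_head //= dproj_dinj.
by rewrite big1 ?addr0 // => j ji; rewrite dproj_dinj_neq ?linear0 // eq_sym.
Qed.

End DirectSum.

(** * Elements of tensor products *)

Lemma in_catl T (x : T) s t : List.In x s -> List.In x (s ++ t).
Proof. by move=> xs; apply: List.in_or_app; left. Qed.

Lemma in_catr T (x : T) s t : List.In x t -> List.In x (s ++ t).
Proof. by move=> xt; apply: List.in_or_app; right. Qed.

Section Tensor.
Variable R : pzRingType.
Implicit Types (A B C : lmodType R^c) (M N P : lmodType R).

(** The map of free abelian groups is defined for arbitrary functions, because it
    will be applied to sections that respect only finitely many relations. *)
Definition freeg_bimap A B M N (f : A -> B) (g : M -> N) :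
    {freeg (A * M)%type} -> {freeg (B * N)%type} :=
  fglift (fun p => tgen (f p.1) (g p.2)).

Lemma freeg_bimap_tgen A B M N (f : A -> B) (g : M -> N) a m :
  freeg_bimap f g (tgen a m) = tgen (f a) (g m).
Proof. by rewrite /freeg_bimap liftU scale1r. Qed.

Lemma freeg_bimapB A B M N (f : A -> B) (g : M -> N) x y :
  freeg_bimap f g (x - y) = freeg_bimap f g x - freeg_bimap f g y.
Proof. exact: lift_is_additive. Qed.

Lemma freeg_bimap0 A B M N (f : A -> B) (g : M -> N) : freeg_bimap f g 0 = 0.
Proof. by rewrite -(subrr 0) freeg_bimapB subrr. Qed.

Lemma freeg_bimapD A B M N (f : A -> B) (g : M -> N) x y :
  freeg_bimap f g (x + y) = freeg_bimap f g x + freeg_bimap f g y.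
Proof. by rewrite -{1}[y]opprK -[- y]add0r !freeg_bimapB freeg_bimap0 sub0r opprK. Qed.

Lemma freeg_ind A M (Q : {freeg (A * M)%type} -> Prop) :
    Q 0 -> (forall a m, Q (tgen a m)) -> (forall x y, Q x -> Q y -> Q (x - y)) ->
  forall x, Q x.
Proof.
move=> P0 Pgen PB x.
have PN y : Q y -> Q (- y) by move=> ?; rewrite -sub0r; exact: PB.
have PD y z : Q y -> Q z -> Q (y + z).
  by move=> ? ?; rewrite -[z]opprK; apply/PB/PN.
rewrite -[x]freeg_sumE; elim/big_ind: _ => // -[a m] _.
rewrite -[coeff _ _]intz -freegU_mulz.
case: (coeff _ _) => n; rewrite ?NegzE ?mulrNz -pmulrn.
  by elim: n => [|n IHn] //; rewrite mulrS; apply: PD => //; exact: Pgen.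
by apply: PN; elim: n => [|n IHn]; [|rewrite mulrS; apply: PD => //]; exact: Pgen.
Qed.

Lemma freeg_bimap_comp A B C M N P (f : A -> B) (g : M -> N)
    (f' : B -> C) (g' : N -> P) x :
  freeg_bimap f' g' (freeg_bimap f g x) = freeg_bimap (f' \o f) (g' \o g) x.
Proof.
elim/freeg_ind: x => [|a m|x y IHx IHy]; rewrite ?freeg_bimap0 ?freeg_bimap_tgen //.
by rewrite !freeg_bimapB IHx IHy.
Qed.

Lemma freeg_bimap_id A M x : freeg_bimap (@id A) (@id M) x = x.
Proof.
elim/freeg_ind: x => [|a m|x y IHx IHy]; rewrite ?freeg_bimap0 ?freeg_bimap_tgen //.
by rewrite !freeg_bimapB IHx IHy.
Qed.

Lemma freeg_bimap_eq_on A M x : exists ms : seq M, forall N (g g' : M -> N),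
    (forall m, List.In m ms -> g m = g' m) ->
  freeg_bimap (@id A) g x = freeg_bimap id g' x.
Proof.
elim/freeg_ind: x => [|a m|x y [ms xP] [ns yP]].
- by exists [::] => *; rewrite !freeg_bimap0.
- by exists [:: m] => N g g' gg'; rewrite !freeg_bimap_tgen gg' //; left.
- exists (ms ++ ns) => N g g' gg'; rewrite !freeg_bimapB.
  by rewrite (xP _ g g') ?(yP _ g g') // => m ?; apply: gg'; apply: List.in_or_app; tauto.
Qed.

Lemma tensor_proj_surj A M (t : tensor A M) : exists x, tensor_proj x = t.
Proof. by exists (repr t); exact: reprK. Qed.

Lemma tensor_proj0 A M : tensor_proj 0 = 0 :> tensor A M.
Proof. by rewrite /tensor_proj raddf0. Qed.

Lemma tensor_projB A M (x y : {freeg (A * M)%type}) :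
  tensor_proj (x - y) = tensor_proj x - tensor_proj y.
Proof. exact: raddfB. Qed.

Lemma tensor_projN A M (x : {freeg (A * M)%type}) :
  tensor_proj (- x) = - tensor_proj x.
Proof. exact: raddfN. Qed.

Lemma tensor_proj_eq0 A M (x : {freeg (A * M)%type}) :
  tensor_proj x = 0 <-> tensor_rel x.
Proof.
rewrite -tensor_proj0.
have := Quotient.idealrBE (tensor_ker (A:=A) (M:=M)) x 0.
rewrite subr0 -topredE /= /tensor_ker => E; rewrite /tensor_proj.
by split=> [/eqP|?]; [rewrite -E => /asboolP | apply/eqP; rewrite -E; exact/asboolP].
Qed.

Lemma tensor_map_freeg A B M N (f : {linear A -> B}) (g : {linear M -> N}) x :
  tensor_map f g (tensor_proj x) = tensor_proj (freeg_bimap f g x).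
Proof. exact: tensor_map_proj. Qed.

Lemma tmul0m A M m : tmul (0 : A) (m : M) = 0.
Proof.
have /tensor_proj_eq0 := @tensor_relDl R A M 0 0 m.
by rewrite addr0 opprD addNKr tensor_projN => /eqP; rewrite oppr_eq0 => /eqP.
Qed.

Lemma tmulm0 A M a : tmul (a : A) (0 : M) = 0.
Proof.
have /tensor_proj_eq0 := @tensor_relDr R A M a 0 0.
by rewrite addr0 opprD addNKr tensor_projN => /eqP; rewrite oppr_eq0 => /eqP.
Qed.

Lemma tensor_map_comp0 A B C M N P (f : {linear A -> B}) (g : {linear M -> N})
    (f' : {linear B -> C}) (g' : {linear N -> P}) :
    (forall a, f' (f a) = 0) \/ (forall m, g' (g m) = 0) ->
  forall t, tensor_map f' g' (tensor_map f g t) = 0.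
Proof.
move=> fg0 t; have [x <-] := tensor_proj_surj t.
elim/freeg_ind: x => [|a m|x y IHx IHy].
- by rewrite tensor_proj0 !raddf0.
- rewrite !tensor_map_freeg !freeg_bimap_tgen.
  by case: fg0 => ->; [exact: tmul0m | exact: tmulm0].
- by rewrite tensor_projB !raddfB /= IHx IHy subr0.
Qed.

End Tensor.

(** * AC-acyclic complexes and pure epimorphisms *)

Section Complexes.
Variable R : pzRingType.

Record complex := Complex {
  ob :> int -> lmodType R;
  df : forall n, {linear ob (n + 1) -> ob n}
}.

Definition AC_acyclic (F : complex) : Prop :=
  [/\ forall n, flat (F n),
      forall n, exact_at (df F (n + 1)) (df F n) &
      forall A : lmodType R^c, absolutely_clean A -> forall n,
        exact_at (tensor_map (idfun : {linear A -> A}) (df F (n + 1)))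
                 (tensor_map (idfun : {linear A -> A}) (df F n))].

(** One linear relation between elements of F; [FElt] lists an element about which
    something else is required.  Finite lists of facts play the role of finite
    systems of linear equations. *)
Inductive fact (F : complex) :=
| FAdd n (x y : F n)
| FScale n (r : R) (x : F n)
| FDiff n (x : F (n + 1))
| FElt n (x : F n).

Definition respects (F G : complex) (s : forall n, F n -> G n) (f : fact F) : Prop :=
  match f with
  | FAdd n x y => s n (x + y) = s n x + s n y
  | FScale n r x => s n (r *: x) = r *: s n x
  | FDiff n x => s n (df F n x) = df G n (s (n + 1) x)
  | FElt n x => True
  end.

Definition at_elt (F : complex) (P : forall n, F n -> Prop) (f : fact F) : Prop :=
  if f is FElt n x then P n x else True.

(** Finite systems of linear relations lift along p.  The section s is only a
    family of functions. *)
Definition pure_epi (F Q : complex) (p : forall n, {linear F n -> Q n}) : Prop :=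
  forall L : seq (fact Q), exists s : forall n, Q n -> F n,
    forall f, List.In f L ->
      respects s f /\ at_elt (fun n q => p n (s n q) = q) f.

(** A derivation of x = 0 in the tensor product uses finitely many relations of Q
    and is transported by any function that respects them. *)
Lemma tensor_rel_transfer (A : lmodType R^c) (Q : complex) n
    (x : {freeg (A * Q n)%type}) :
  tensor_rel x -> exists L : seq (fact Q),
    forall (F : complex) (s : forall n, Q n -> F n),
    (forall f, List.In f L -> respects s f) ->
    tensor_rel (freeg_bimap id (s n) x).
Proof.
elim=> [|u v _ [L uP] _ [L' vP]|a a' m|a m m'|a r m].
- by exists [::] => *; rewrite freeg_bimap0; exact: tensor_rel0.
- exists (L ++ L') => F s sL; rewrite freeg_bimapB.
  by apply: tensor_relB; [apply: uP|apply: vP] => f fL; apply: sL;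
    apply: List.in_or_app; tauto.
- exists [::] => F s _; rewrite freeg_bimapB freeg_bimapD !freeg_bimap_tgen.
  exact: tensor_relDl.
- exists [:: FAdd m m'] => F s /(_ _ (or_introl erefl)) /= sm.
  rewrite freeg_bimapB freeg_bimapD !freeg_bimap_tgen sm; exact: tensor_relDr.
- exists [:: FScale r m] => F s /(_ _ (or_introl erefl)) /= sm.
  rewrite freeg_bimapB !freeg_bimap_tgen sm; exact: tensor_rel_bal.
Qed.

(** The three conditions are proved in the same way: that an element t is killed
    is witnessed by finitely many relations, so that t lifts to an element over F
    that is killed too; the element of which this lift is the image is then
    pushed forward along p. *)
Lemma AC_acyclic_pure_quotient (F Q : complex) (p : forall n, {linear F n -> Q n}) :
    (forall n x, p n (df F n x) = df Q n (p (n + 1) x)) -> pure_epi p ->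
  AC_acyclic F -> AC_acyclic Q.
Proof.
move=> pd p_pure [F_flat F_exact F_Aexact].
have p_surj n q : exists x, p n x = q.
  have [s sP] := p_pure [:: FElt q].
  by exists (s n q); have [_] := sP _ (or_introl erefl).
split=> [n A B C f g fg|n q|A A_clean n t].
- move=> t; split=> [gt0|[u <-]]; last first.
    by apply: tensor_map_comp0; left => a; apply/fg; exists a.
  have [x def_t] := tensor_proj_surj t; rewrite -{}def_t in gt0 *.
  move: gt0; rewrite tensor_map_freeg => /tensor_proj_eq0/tensor_rel_transfer[L LP].
  have [ms msP] := freeg_bimap_eq_on x.
  have [s sP] := p_pure (L ++ [seq FElt m | m <- ms]).
  have /tensor_proj_eq0 :=
    LP _ s (fun f fL => proj1 (sP f (in_catl _ fL))).
  rewrite freeg_bimap_comp => gs0.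
  have /(proj1 (F_flat n _ _ _ _ _ fg _))[u fu] :
      tensor_map g idfun (tensor_proj (freeg_bimap id (s n) x)) = 0.
    by rewrite tensor_map_freeg freeg_bimap_comp.
  exists (tensor_map idfun (p n) u).
  have [y def_u] := tensor_proj_surj u; rewrite -{}def_u in fu *.
  transitivity (tensor_map idfun (p n) (tensor_map f idfun (tensor_proj y))).
    by rewrite !tensor_map_freeg !freeg_bimap_comp.
  rewrite fu tensor_map_freeg freeg_bimap_comp; congr tensor_proj.
  rewrite -[RHS]freeg_bimap_id; apply: msP => m m_ms /=.
  exact: (proj2 (sP _ (in_catr _ (List.in_map (@FElt Q n) _ _ m_ms)))).
- split=> [dq0|[u <-]]; last first.
    have [x <-] := p_surj _ u; rewrite -!pd.
    by have /(F_exact n) -> : exists u, df F (n + 1) u = df F (n + 1) x;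
      [exists x | rewrite linear0].
  have [s sP] := p_pure [:: FDiff q; FElt q; FAdd (0 : Q n) 0].
  have [/= dsq _] := sP _ (or_introl erefl).
  have [/= _ psq] := sP _ (or_intror (or_introl erefl)).
  have [/= s0 _] := sP _ (or_intror (or_intror (or_introl erefl))).
  have /(F_exact n)[u du] : df F n (s (n + 1) q) = 0.
    by rewrite -dsq dq0; apply: (@addrI _ (s n 0)); rewrite -s0 !addr0.
  by exists (p _ u); rewrite -pd du.
- split=> [dt0|[u <-]]; last first.
    apply: tensor_map_comp0; right => m.
    have [x <-] := p_surj _ m; rewrite -!pd.
    by have /(F_exact n) -> : exists u, df F (n + 1) u = df F (n + 1) x;
      [exists x | rewrite linear0].
  have [x def_t] := tensor_proj_surj t; rewrite -{}def_t in dt0 *.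
  move: dt0; rewrite tensor_map_freeg => /tensor_proj_eq0/tensor_rel_transfer[L LP].
  have [ms msP] := freeg_bimap_eq_on x.
  have [s sP] := p_pure (L ++ [seq FElt m | m <- ms] ++ [seq FDiff m | m <- ms]).
  have /tensor_proj_eq0 :=
    LP _ s (fun f fL => proj1 (sP f (in_catl _ fL))).
  rewrite freeg_bimap_comp => ds0.
  have /(F_Aexact A A_clean n)[u du] :
      tensor_map idfun (df F n) (tensor_proj (freeg_bimap id (s (n + 1)) x)) = 0.
    rewrite -ds0 tensor_map_freeg freeg_bimap_comp; congr tensor_proj.
    apply: msP => m m_ms /=.
    have m_in := List.in_map (@FDiff Q n) _ _ m_ms.
    exact: esym (proj1 (sP _ (in_catr _ (in_catr _ m_in)))).
  exists (tensor_map idfun (p _) u).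
  have [y def_u] := tensor_proj_surj u; rewrite -{}def_u in du *.
  transitivity (tensor_map idfun (p _)
    (tensor_map idfun (df F (n + 1)) (tensor_proj y))).
    rewrite !tensor_map_freeg !freeg_bimap_comp; congr tensor_proj.
    have [ns nsP] := freeg_bimap_eq_on y; apply: nsP => m _ /=; exact/esym/pd.
  rewrite du tensor_map_freeg freeg_bimap_comp; congr tensor_proj.
  rewrite -[RHS]freeg_bimap_id; apply: msP => m m_ms /=.
  exact: (proj2 (sP _ (in_catr _ (in_catl _ (List.in_map (@FElt Q _) _ _ m_ms))))).
Qed.

End Complexes.

(** * Direct sums of AC-acyclic complexes *)

Section DirectSumComplex.
Variables (R : pzRingType) (I : choiceType).

Section DsumMap.
Variables (U V : I -> lmodType R) (f : forall i, {linear U i -> V i}).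

Fact dsum_map_supported (x : dsum U) :
  exists s, supported s (fun i => f i (dval x i)).
Proof.
by have [s sx] := dval_supported x; exists s => i /sx ->; rewrite linear0.
Qed.

Definition dsum_map (x : dsum U) : dsum V := dmk (dsum_map_supported x).

Fact dsum_map_linear : linear dsum_map.
Proof. by move=> a x y; apply: dsum_ext => i; exact: linearP. Qed.

HB.instance Definition _ :=
  GRing.isLinear.Build R (dsum U) (dsum V) *:%R dsum_map dsum_map_linear.

Lemma dproj_map i x : dproj i (dsum_map x) = f i (dproj i x).
Proof. by []. Qed.

Lemma dsum_map_inj i u : dsum_map (dinj u) = dinj (f i u).
Proof.
apply: dsum_ext => j; rewrite -!/(dproj _ _) dproj_map.
have [<-|ij] := eqVneq i j; first by rewrite !dproj_dinj.
by rewrite !dproj_dinj_neq ?linear0.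
Qed.

End DsumMap.

(** Exactness checked on components, for any additive functor whose value on a
    direct sum consists of finite sums of components; the functors used are the
    identity and the tensor products. *)
Lemma exact_dsum (X Y Z : zmodType) (f : {additive X -> Y}) (g : Y -> Z)
    (X' Y' Z' : I -> zmodType) (f' : forall i, X' i -> Y' i)
    (g' : forall i, Y' i -> Z' i) (inX : forall i, X' i -> X)
    (inY : forall i, Y' i -> Y) (prY : forall i, Y -> Y' i)
    (prZ : forall i, Z -> Z' i) y :
    (forall i, exact_at (f' i) (g' i)) ->
    (forall i x, f (inX i x) = inY i (f' i x)) ->
    (forall i z, prZ i (g z) = g' i (prY i z)) -> (forall i, prZ i 0 = 0) ->
    (exists s : seq I, y = \sum_(i <- s) inY i (prY i y)) ->
  g y = 0 -> exists x, f x = y.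
Proof.
move=> ex fin gpr prZ0 [s def_y] gy0.
have lift i : exists x, f' i x = prY i y.
  by apply/(ex i); rewrite -gpr gy0 prZ0.
pose u i := projT1 (cid (lift i)).
have uP i : f' i (u i) = prY i y by rewrite /u; case: cid.
exists (\sum_(i <- s) inX i (u i)).
by rewrite raddf_sum [RHS]def_y; apply: eq_bigr => i _; rewrite fin uP.
Qed.

Lemma tmulDr (A : lmodType R^c) (M : lmodType R) (a : A) (m m' : M) :
  tmul a (m + m') = tmul a m + tmul a m'.
Proof.
apply/eqP; rewrite -subr_eq0 -!raddfD -raddfB; apply/eqP/tensor_proj_eq0.
exact: tensor_relDr.
Qed.

Lemma tensor_dsum_sum (A : lmodType R^c) (U : I -> lmodType R)
    (t : tensor A (dsum U)) :
  exists s : seq I, t = \sum_(i <- s)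
    tensor_map idfun (dinj (i := i)) (tensor_map idfun (dproj i) t).
Proof.
(* One list has to serve both terms of a difference, hence the claim for all
   large lists. *)
suff [s sP] : exists s0 : seq I, forall s, uniq s -> {subset s0 <= s} ->
    t = \sum_(i <- s)
      tensor_map idfun (dinj (i := i)) (tensor_map idfun (dproj i) t).
  by exists (undup s); apply: sP => [|i]; rewrite ?undup_uniq ?mem_undup.
have [x <-] := tensor_proj_surj t; elim/freeg_ind: x => [|a m|x y [s sP] [r rP]].
- by exists [::] => s _ _; rewrite tensor_proj0 big1 // => i _; rewrite !raddf0.
- have [s0 s0P] := dval_supported m; exists s0 => s s_uniq ss0.
  rewrite -/(tmul a m); under eq_bigr => i _ do rewrite !tensor_map_tmul.
  have {1}-> := dsum_sum s_uniq (supportedS ss0 s0P).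
  elim/big_rec2: _ => [|i z z' _]; first exact: tmulm0.
  by move=> <-; exact: tmulDr.
- exists (s ++ r) => q q_uniq qsr.
  under eq_bigr => i _ do rewrite tensor_projB !raddfB.
  rewrite sumrB -sP // => [|i i_s]; last by apply: qsr; rewrite mem_cat i_s.
  rewrite -rP ?tensor_projB // => i i_r.
  by apply: qsr; rewrite mem_cat i_r orbT.
Qed.

Variable G : I -> complex R.

Definition dsum_cplx : complex R :=
  @Complex R (fun n => dsum (fun i => G i n))
    (fun n => dsum_map (fun i => df (G i) n)).

Lemma tensor_map_comp_eq (A B C D : lmodType R^c) (M N P Q : lmodType R)
    (f : {linear A -> B}) (g : {linear M -> N})
    (f' : {linear B -> D}) (g' : {linear N -> Q})
    (h : {linear A -> C}) (k : {linear M -> P})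
    (h' : {linear C -> D}) (k' : {linear P -> Q}) t :
    (forall a, f' (f a) = h' (h a)) -> (forall m, g' (g m) = k' (k m)) ->
  tensor_map f' g' (tensor_map f g t) = tensor_map h' k' (tensor_map h k t).
Proof.
move=> fh gk; have [x <-] := tensor_proj_surj t.
rewrite !tensor_map_freeg !freeg_bimap_comp; congr (tensor_proj (freeg_bimap _ _ x)).
  exact: funext.
exact: funext.
Qed.

Lemma AC_acyclic_dsum : (forall i, AC_acyclic (G i)) -> AC_acyclic dsum_cplx.
Proof.
move=> GG; have df2 n x : df dsum_cplx n (df dsum_cplx (n + 1) x) = 0.
  apply: dsum_ext => i; have [_ Gex _] := GG i.
  by have /Gex : exists u, df (G i) (n + 1) u = df (G i) (n + 1) (dval x i);
    [exists (dval x i) | exact].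
split=> [n A B C f g fg|n x|A A_clean n t].
- move=> t; split=> [|[u <-]]; last first.
    by apply: tensor_map_comp0; left => a; apply/fg; exists a.
  apply: (exact_dsum
    (f' := fun i => tensor_map f (idfun : {linear G i n -> G i n}))
    (g' := fun i => tensor_map g (idfun : {linear G i n -> G i n}))
    (inX := fun i => tensor_map idfun (dinj (U := fun i => G i n) (i := i)))
    (inY := fun i => tensor_map idfun (dinj (U := fun i => G i n) (i := i)))
    (prY := fun i => tensor_map idfun (dproj (U := fun i => G i n) i))
    (prZ := fun i => tensor_map idfun (dproj (U := fun i => G i n) i))
    _ _ _ _ (tensor_dsum_sum t)).
  + by move=> i; have [Gf _ _] := GG i; exact: (Gf n _ _ _ _ _ fg).
  + by move=> i u; refine (tensor_map_comp_eq _ _ _).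
  + by move=> i u; refine (tensor_map_comp_eq _ _ _).
  + by move=> i; rewrite raddf0.
- split=> [|[u <-]]; last exact: df2.
  have [s sx] := dval_supported x.
  apply: (exact_dsum (f := df dsum_cplx (n + 1))
    (f' := fun i => df (G i) (n + 1)) (g' := fun i => df (G i) n)
    (inX := fun i => @dinj _ _ (fun i => G i _) i)
    (inY := fun i => @dinj _ _ (fun i => G i _) i)
    (prY := fun i => @dproj _ _ (fun i => G i _) i)
    (prZ := fun i => @dproj _ _ (fun i => G i _) i)).
  + by move=> i; have [_ + _] := GG i.
  + by move=> i u; exact: dsum_map_inj.
  + by [].
  + by [].
  + exists (undup s); apply: dsum_sum; rewrite ?undup_uniq //.
    by apply: supportedS sx => i; rewrite mem_undup.
- split=> [|[u <-]]; last by apply: tensor_map_comp0; right => m; exact: df2.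
  apply: (exact_dsum
    (f' := fun i => tensor_map idfun (df (G i) (n + 1)))
    (g' := fun i => tensor_map idfun (df (G i) n))
    (inX := fun i => tensor_map idfun (dinj (U := fun i => G i _) (i := i)))
    (inY := fun i => tensor_map idfun (dinj (U := fun i => G i (n + 1)) (i := i)))
    (prY := fun i => tensor_map idfun (dproj (U := fun i => G i (n + 1)) i))
    (prZ := fun i => tensor_map idfun (dproj (U := fun i => G i n) i))
    _ _ _ _ (tensor_dsum_sum t)).
  + by move=> i; have [_ _ Gex] := GG i; exact: (Gex A A_clean n).
  + by move=> i u; by refine (tensor_map_comp_eq _ _ _) => // m; exact: dsum_map_inj.
  + by move=> i u; refine (tensor_map_comp_eq _ _ _).
  + by move=> i; rewrite raddf0.
Qed.

End DirectSumComplex.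

(** * Pure subcomplexes *)

Section Purity.
Variable R : pzRingType.

Record subcplx (F : complex R) := Subcplx {
  sub :> forall n, submod (F n);
  sub_df : forall n x, sub (n + 1) x -> sub n (df F n x)
}.

(** If t is id - r, the conditions say that r maps the listed elements to P, fixes
    those that lie in P, and respects the listed relations: solutions in F of a
    finite system with parameters in P can be replaced by solutions in P.  In terms
    of t, finite systems lift from F/P to F; this form composes along successive
    quotients. *)
Definition pure (F : complex R) (P : subcplx F) : Prop :=
  forall L : seq (fact F), exists t : forall n, F n -> F n,
    forall f, List.In f L -> respects t f /\
      at_elt (fun n x => P n (x - t n x) /\ (P n x -> t n x = 0)) f.

Definition sub_in (F : complex R) (P : subcplx F) (K : forall n, F n -> Prop) :=
  forall n x, P n x -> K n x.

Section QuotientComplex.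
Variables (F : complex R) (P : subcplx F).

Fact quot_df_ex n : exists g : {linear quot (P (n + 1)) -> quot (P n)},
  forall x, g (quot_proj (P (n + 1)) x) = quot_proj (P n) (df F n x).
Proof.
apply: (linear_factor_surj (e := quot_proj (P (n + 1)))
  (f := quot_proj (P n) \o df F n)) => [q|x /quot_proj_eq0 Px].
  exact: quot_proj_surj.
by apply/quot_proj_eq0/sub_df.
Qed.

Definition quot_cplx : complex R :=
  @Complex R (fun n => quot (P n)) (fun n => projT1 (cid (quot_df_ex n))).

Arguments quot_cplx : simpl never.

Definition qpi n : {linear F n -> quot_cplx n} := quot_proj (P n).

Arguments qpi : simpl never.

Lemma qpi_df n x : qpi n (df F n x) = df quot_cplx n (qpi (n + 1) x).
Proof. by rewrite /quot_cplx /=; case: cid => g /= ->. Qed.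

Lemma qpi_eq0 n x : qpi n x = 0 <-> P n x.
Proof. exact: quot_proj_eq0. Qed.

Lemma qpi_surj n q : exists x, qpi n x = q.
Proof. exact: quot_proj_surj. Qed.

(** The section is t composed with a choice s of representatives.  For instance
    s (q + q') - (s q + s q') lies in P, so it is enough that t kills it and
    respects the relations needed to express this. *)
Lemma pure_quot : pure P -> pure_epi qpi.
Proof.
move=> P_pure L; pose s n q : F n := projT1 (cid (@qpi_surj n q)).
have sK n q : qpi n (s n q) = q by rewrite /s; case: cid.
pose lift (f : fact quot_cplx) : seq (fact F) := match f with
  | FAdd n q q' => let p := s n (q + q') - (s n q + s n q') in
      [:: FAdd (s n q) (s n q'); FAdd p (s n q + s n q'); FElt p]
  | FScale n r q => let p := s n (r *: q) - r *: s n q in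
      [:: FScale r (s n q); FAdd p (r *: s n q); FElt p]
  | FDiff n q => let p := s n (df _ n q) - df F n (s (n + 1) q) in
      [:: FDiff (s (n + 1) q); FAdd p (df F n (s (n + 1) q)); FElt p]
  | FElt n q => [:: FElt (s n q)]
  end.
have [t tP] := P_pure (List.flat_map lift L).
exists (fun n q => t n (s n q)) => f fL.
have {tP}tP g : List.In g (lift f) -> respects t g /\
    at_elt (fun n x => P n (x - t n x) /\ (P n x -> t n x = 0)) g.
  by move=> gf; apply/tP/List.in_flat_map; exists f.
case: f tP {fL} => n /= => [q q'|r q|q|q] tP.
- have [/= tD _] := tP _ (or_introl erefl).
  have [/= tD' _] := tP _ (or_intror (or_introl erefl)).
  have [_ [_ t0]] := tP _ (or_intror (or_intror (or_introl erefl))).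
  split=> //; rewrite -tD -[in LHS](subrK (s n q + s n q') (s n (q + q'))).
  rewrite tD' t0 ?add0r //.
  by apply/qpi_eq0; rewrite linearB linearD !sK subrr.
- have [/= tZ _] := tP _ (or_introl erefl).
  have [/= tD' _] := tP _ (or_intror (or_introl erefl)).
  have [_ [_ t0]] := tP _ (or_intror (or_intror (or_introl erefl))).
  split=> //; rewrite -tZ -[in LHS](subrK (r *: s n q) (s n (r *: q))).
  rewrite tD' t0 ?add0r //.
  by apply/qpi_eq0; rewrite linearB linearZ !sK subrr.
- have [/= td _] := tP _ (or_introl erefl).
  have [/= tD' _] := tP _ (or_intror (or_introl erefl)).
  have [_ [_ t0]] := tP _ (or_intror (or_intror (or_introl erefl))).
  split=> //; rewrite -td.
  rewrite -[in LHS](subrK (df F n (s (n + 1) q)) (s n (df quot_cplx n q))).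
  rewrite tD' t0 ?add0r //.
  by apply/qpi_eq0; rewrite linearB qpi_df !sK subrr.
- have [_ [/qpi_eq0 + _]] := tP _ (or_introl erefl).
  by rewrite linearB sK => /eqP; rewrite subr_eq0 => /eqP.
Qed.

Variable S : subcplx quot_cplx.

Definition preim_submod n : submod (F n).
Proof.
exists (fun x => S n (qpi n x)); first by rewrite linear0; exact: smem0.
by move=> a x y Sx Sy; rewrite linearP; exact: smemP.
Defined.

Definition preim_subcplx : subcplx F.
Proof. by exists preim_submod => n x /= Sx; rewrite qpi_df; exact: sub_df. Defined.

(** The map required for the preimage of S is the composite of the projection,
    the map given by purity of S, and a section given by purity of P that respects
    the finitely many relations produced by the second. *)
Lemma pure_preim : pure P -> pure S -> pure preim_subcplx.
Proof.
move=> /pure_quot pi_pure S_pure L.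
pose im (f : fact F) : fact quot_cplx := match f with
  | FAdd n x y => FAdd (qpi n x) (qpi n y)
  | FScale n r x => FScale r (qpi n x)
  | FDiff n x => @FDiff _ quot_cplx _ (qpi (n + 1) x)
  | FElt n x => FElt (qpi n x)
  end.
have [t tP] := S_pure [seq im f | f <- L].
pose im2 (f : fact F) : seq (fact quot_cplx) := match f with
  | FAdd n x y => [:: FAdd (t _ (qpi n x)) (t _ (qpi n y))]
  | FScale n r x => [:: FScale r (t _ (qpi n x))]
  | FDiff n x => [:: @FDiff _ quot_cplx _ (t _ (qpi (n + 1) x))]
  | FElt n x => [:: FElt (t _ (qpi n x)); FAdd (0 : quot_cplx n) 0]
  end.
have [s sP] := pi_pure (List.flat_map im2 L).
exists (fun n x => s n (t n (qpi n x))) => f fL.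
have {tP}tP := tP _ (List.in_map im _ _ fL).
have {}sP g : List.In g (im2 f) -> respects s g /\
    at_elt (fun n q => qpi n (s n q) = q) g.
  by move=> gf; apply/sP/List.in_flat_map; exists f.
case: f tP sP {fL} => n /= => [x y|r x|x|x] [tL tE] sP; split=> //.
- by have [/= sD _] := sP _ (or_introl erefl); rewrite linearD tL sD.
- by have [/= sZ _] := sP _ (or_introl erefl); rewrite linearZ tL sZ.
- by have [/= sd _] := sP _ (or_introl erefl); rewrite qpi_df tL sd.
- have sE : qpi n (s n (t n (qpi n x))) = t n (qpi n x).
    exact: proj2 (sP _ (or_introl erefl)).
  have [/= s0 _] := sP _ (or_intror (or_introl erefl)).
  have [tE1 tE2] := tE; split=> [|Sx]; first by rewrite linearB sE.
  by rewrite tE2 //; apply: (@addrI _ (s n 0)); rewrite -s0 !addr0.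
Qed.

End QuotientComplex.

Definition zero_submod (U : lmodType R) : submod U.
Proof. by exists (fun x => x = 0) => // a x y -> ->; rewrite scaler0 addr0. Defined.

Definition zero_subcplx (F : complex R) : subcplx F.
Proof. by exists (fun n => zero_submod (F n)) => n x /= ->; rewrite linear0. Defined.

Lemma pure_zero (F : complex R) : pure (zero_subcplx F).
Proof.
move=> L; exists (fun n x => x) => f _.
by case: f => //= n x; rewrite subrr.
Qed.

(** The finitely many elements listed in a purity problem for the union of a chain
    lie in one member of it, and a solution for this member is a solution for the
    union. *)
Lemma pure_maximal (F : complex R) (K : forall n, F n -> Prop) :
    (forall n, K n 0) ->
  exists P : subcplx F, [/\ pure P, sub_in P K & forall P' : subcplx F,
    pure P' -> sub_in P' K -> sub_in P (fun n => P' n) ->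
    sub_in P' (fun n => P n)].
Proof.
move=> K0; pose T := {P : subcplx F | pure P /\ sub_in P K}.
have zeroT : pure (zero_subcplx F) /\ sub_in (zero_subcplx F) K.
  by split=> [|n x /= ->]; [exact: pure_zero | exact: K0].
pose Z : T := exist _ (zero_subcplx F) zeroT.
pose le (P P' : T) := `[< sub_in (sval P) (fun n => sval P' n) >].
have [||A A_total|P P_max] := @ZL_preorder T Z le.
- by move=> P; apply/asboolP => n x.
- move=> P P' P'' /asboolP le1 /asboolP le2; apply/asboolP => n x ?.
  exact/le2/le1.
(* Adding the zero subcomplex to the chain makes its union contain 0. *)
- pose B (P : T) := A P \/ P = Z.
  have B_total P P' : B P -> B P' ->
      sub_in (sval P) (fun n => sval P' n) \/ sub_in (sval P') (fun n => sval P n).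
    move=> [AP|->] [AP'|->].
    + by have [/asboolP|/asboolP] := A_total P P' AP AP'; [left|right].
    + by right=> n x ->; exact: smem0.
    + by left=> n x ->; exact: smem0.
    + by left.
  pose U n x := exists2 P : T, B P & sval P n x.
  have U2 n x m y : U n x -> U m y ->
      exists2 P : T, B P & sval P n x /\ sval P m y.
    move=> [P BP Px] [P' BP' P'y].
    by have [le1|le1] := B_total P P' BP BP'; [exists P'|exists P] => //;
      split=> //; exact: le1.
  have U0 n : U n 0 by exists Z => //; right.
  have U_sub n a x y : U n x -> U n y -> U n (a *: x + y).
    move=> Ux Uy; have [P BP [Px Py]] := U2 _ _ _ _ Ux Uy.
    by exists P => //; exact: smemP.
  pose Us n := Submod (U0 n) (@U_sub n).
  have Us_df n x : Us (n + 1) x -> Us n (df F n x).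
    by move=> [P BP Px]; exists P => //; exact: sub_df.
  pose Uc := @Subcplx F Us Us_df.
  have Uc_pure : pure Uc.
    move=> L; suff [P BP UP] : exists2 P : T, B P &
        forall f, List.In f L -> at_elt (fun n x => U n x -> sval P n x) f.
      have [t tP] := proj1 (svalP P) L; exists t => f fL.
      have [fr fE] := tP _ fL; split=> //.
      case: f {fL fr} fE (UP f fL) => //= n x [Px P0] UPx; split; first by exists P.
      by move=> /UPx.
    elim: L => [|f L [P BP UP]]; first by exists Z => //; right.
    suff [P' BP' [PP' P'f]] : exists2 P' : T, B P' &
        sub_in (sval P) (fun n => sval P' n)
        /\ at_elt (fun n x => U n x -> sval P' n x) f.
      exists P' => // g [<- //|/UP]; case: g => //= n x UPx /UPx; exact: PP'.
    case: f => [n x y|n r x|n x|n x] /=; try by exists P => //; split.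
    have [[P' BP' P'x]|nUx] := pselect (U n x); last by exists P => //; split.
    have [le1|le1] := B_total P P' BP BP'; first by exists P'.
    by exists P => //; split=> // _; exact: le1.
  have Uc_in : sub_in Uc K by move=> n x [P BP Px]; exact: (proj2 (svalP P)).
  exists (exist (fun P : subcplx F => pure P /\ sub_in P K) Uc
    (conj Uc_pure Uc_in)) => P AP; apply/asboolP => n x Px.
  by exists P => //; left.
- exists (sval P); have [P_pure PK] := svalP P; split=> // P' P'_pure P'K PP'.
  have /asboolP := P_max (exist (fun P : subcplx F => pure P /\ sub_in P K) P'
    (conj P'_pure P'K)) (asboolT PP').
  by [].
Qed.

End Purity.

(** * Saturation by Skolem terms *)

(** A term [Skolem c g i] names the i-th entry of a chosen I-indexed family that
    satisfies the relations c and agrees with the elements named by g where g is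
    defined.  K is the type of relation symbols. *)
Inductive skolem (K I : Type) : Type :=
  Skolem (c : K -> I -> I -> I -> Prop) (g : I -> option (skolem K I)) (i : I).

(** The type of names depends only on K and I, and not on the structure A.  To
    imitate v inside the image of ev, take for c all the relations that hold
    between the entries of v and let g record which entries are already named. *)
Lemma saturation (K I A : Type) (a0 : A) (rel : K -> A -> A -> A -> Prop) :
  exists ev : skolem K I -> A, forall v : I -> A, exists u : I -> skolem K I,
    (forall i, (exists t, ev t = v i) -> ev (u i) = v i) /\
    (forall k i j l, rel k (v i) (v j) (v l) ->
       rel k (ev (u i)) (ev (u j)) (ev (u l))).
Proof.
pose sol (c : K -> I -> I -> I -> Prop) (g : I -> option A) (v : I -> A) :=
  (forall i a, g i = Some a -> v i = a) /\
  (forall k i j l, c k i j l -> rel k (v i) (v j) (v l)).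
have /choice[ch chP] : forall cg : (K -> I -> I -> I -> Prop) * (I -> option A),
    exists v, (exists v', sol cg.1 cg.2 v') -> sol cg.1 cg.2 v.
  move=> cg; have [[v vP]|no] := pselect (exists v', sol cg.1 cg.2 v').
    by exists v.
  by exists (fun=> a0).
pose ev := fix ev (t : skolem K I) : A :=
  let: Skolem c g i := t in
  ch (c, fun j => match g j with Some s => Some (ev s) | None => None end) i.
exists ev => v.
have /choice[g gP] : forall i, exists o : option (skolem K I),
    match o with Some s => ev s = v i | None => ~ exists t, ev t = v i end.
  move=> i; have [[t tP]|no] := pselect (exists t, ev t = v i).
    by exists (Some t).
  by exists None.
pose c k i j l := rel k (v i) (v j) (v l).
have [|fixv pres] :=
  chP (c, fun j => match g j with Some s => Some (ev s) | None => None end).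
  exists v; split=> // i a /=.
  by case: (g i) (gP i) => // s <- [<-].
exists (fun i => Skolem c g i); split=> [i im|k i j l kv]; last exact: pres.
apply: fixv => /=; case: (g i) (gP i) => [s ->|] //.
Qed.

(** * Small pure quotients *)

Section Small.
Variables (R : pzRingType) (M : lmodType R) (n0 : int).

Definition tot (F : complex R) := {n : int & F n}.
Definition el (F : complex R) n (x : F n) : tot F := existT _ n x.

Lemma el_inj (F : complex R) n (x y : F n) : el x = el y -> x = y.
Proof. by move/eqP; rewrite -tag_eqE /tag_eq eqxx tagged_asE => /eqP. Qed.

(** Symbols for the structure of a complex over M as a relational structure on the
    set of all its elements; [SPhi m] says that phi takes the value m. *)
Inductive sym :=
| SEq | SSort of int | SAdd | SScale of R | SDiff | SPhi of M.

Definition rel (F : complex R) (phi : {linear F n0 -> M}) (k : sym)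
    (a b c : tot F) : Prop :=
  match k with
  | SEq => a = b
  | SSort n => exists x : F n, a = el x
  | SAdd => exists n (x y : F n), [/\ a = el x, b = el y & c = el (x + y)]
  | SScale r => exists n (x : F n), a = el x /\ b = el (r *: x)
  | SDiff => exists n (x : F (n + 1)), a = el x /\ b = el (df F n x)
  | SPhi m => exists x : F n0, a = el x /\ phi x = m
  end.

Definition preserves (I : Type) (F G : complex R) (phi : {linear F n0 -> M})
    (psi : {linear G n0 -> M}) (v : I -> tot F) (w : I -> tot G) : Prop :=
  forall k i j l, rel phi k (v i) (v j) (v l) -> rel psi k (w i) (w j) (w l).

Section Preserves.
Variables (I : Type) (F G : complex R) (phi : {linear F n0 -> M})
    (psi : {linear G n0 -> M}) (v : I -> tot F) (w : I -> tot G).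
Hypothesis vw : preserves phi psi v w.

Lemma pres_eq i j : v i = v j -> w i = w j.
Proof. exact: (@vw SEq i j j). Qed.

Lemma pres_sort i n (x : F n) : v i = el x -> exists y : G n, w i = el y.
Proof. by move=> vi; apply: (@vw (SSort n) i i i); exists x. Qed.

Lemma pres_add i j k n (x y : F n) (x' y' : G n) :
    v i = el x -> v j = el y -> v k = el (x + y) ->
    w i = el x' -> w j = el y' -> w k = el (x' + y').
Proof.
move=> vi vj vk wi wj.
have [|m [a [b [wi' wj' ->]]]] := @vw SAdd i j k; first by exists n, x, y.
move: wi'; rewrite wi => wi'; have e := congr1 (@projT1 _ _) wi'.
rewrite /= in e; case: m / e a b wi' wj' => a b /el_inj <-.
by rewrite wj => /el_inj <-.
Qed.

Lemma pres_scale i j n r (x : F n) (x' : G n) :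
  v i = el x -> v j = el (r *: x) -> w i = el x' -> w j = el (r *: x').
Proof.
move=> vi vj wi; have [|m [a [wi' ->]]] := @vw (SScale r) i j j.
  by exists n, x.
move: wi'; rewrite wi => wi'; have e := congr1 (@projT1 _ _) wi'.
by rewrite /= in e; case: m / e a wi' => a /el_inj <-.
Qed.

Lemma pres_diff i j n (x : F (n + 1)) (x' : G (n + 1)) :
  v i = el x -> v j = el (df F n x) -> w i = el x' -> w j = el (df G n x').
Proof.
move=> vi vj wi; have [|m [a [wi' ->]]] := @vw SDiff i j j.
  by exists n, x.
move: wi'; rewrite wi => wi'; have := congr1 (@projT1 _ _) wi'.
by move=> /= /addIr e; case: m / e a wi' => a /el_inj <-.
Qed.

Lemma pres_phi i (x : F n0) (x' : G n0) :
  v i = el x -> w i = el x' -> psi x' = phi x.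
Proof.
move=> vi wi; have [|y [wi' <-]] := @vw (SPhi (phi x)) i i i.
  by exists x.
by move: wi'; rewrite wi => /el_inj ->.
Qed.

Lemma pres_zero i n : v i = el (0 : F n) -> w i = el (0 : G n).
Proof.
move=> vi; have [y wi] := pres_sort vi.
have := pres_add vi vi _ wi wi => /(_ i); rewrite addr0 wi => /(_ vi)/el_inj.
by rewrite -[X in X = _]addr0 => /addrI <-.
Qed.

End Preserves.

(** The kernel of phi viewed as a map from F to the complex with M alone in degree
    n0: there is no condition on x in the other degrees. *)
Definition in_ker (F : complex R) (phi : {linear F n0 -> M}) n (x : F n) : Prop :=
  forall u : F n0, el u = el x -> phi u = 0.

Lemma in_ker_at (F : complex R) (phi : {linear F n0 -> M}) x :
  in_ker phi x <-> phi x = 0.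
Proof. by split=> [/(_ x erefl)//|phix u /el_inj ->]. Qed.

(** The auxiliary terms name a subcomplex closed under solutions of countable
    systems; the two extra symbols are unary predicates.  The terms [gen_term]
    realize every relation type of a family indexed by auxiliary terms. *)
Definition aux_term := skolem (sym + bool) nat.
Definition gen_term := skolem sym aux_term.

(** Let D be the image of ev, a0 an element outside D, and N a subcomplex named by
    auxiliary terms, containing a0 and relatively pure with respect to the
    predicate D.  Saturation of D copies the naming ev0 of N to a naming w inside
    D which agrees with ev0 at the elements of D.  The relation W is the graph of
    the induced map theta on N, and P consists of the elements n - theta(n).  If r
    moves a finite system of F into N, respects it, maps D to D and fixes the
    listed elements of N, then r - theta r moves the system into P and fixes the
    listed elements of P: for e = n - theta(n) with r(theta(n)) = c, one gets
    r(e) = n - c with c in N and D, so that theta(c) = c and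
    r(e) - theta(r(e)) = n - theta(n). *)
Lemma pure_in_ker (F : complex R) (phi : {linear F n0 -> M})
    (ev : gen_term -> tot F) :
    (forall v : aux_term -> tot F, exists u : aux_term -> gen_term,
      (forall i, (exists t, ev t = v i) -> ev (u i) = v i) /\
      preserves phi phi v (ev \o u)) ->
    (exists a, forall t, ev t <> a) ->
  exists P : subcplx F, [/\ pure P, sub_in P (in_ker phi) &
    exists n (x : F n), P n x /\ x <> 0].
Proof.
move=> ev_sat [a0 a0P].
(* true marks membership in D, false marks the point a0. *)
pose rel' (k : sym + bool) (a b c : tot F) : Prop := match k with
  | inl k => rel phi k a b c
  | inr true => exists t, ev t = a
  | inr false => a = a0
  end.
have [ev0 ev0_sat] := @saturation (sym + bool)%type nat (tot F) a0 rel'.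
have [u [u_fix u_pres]] := ev_sat ev0; pose w t := ev (u t).
pose approx (v : nat -> tot F) (i : nat -> aux_term) := [/\
  forall k, (exists t, ev0 t = v k) -> ev0 (i k) = v k,
  preserves phi phi v (ev0 \o i), preserves phi phi v (w \o i) &
  forall k, (exists t, ev t = v k) -> exists t, ev t = ev0 (i k)].
have tableP (s : seq (tot F)) : exists v i, [/\ approx v i,
    forall a, List.In a s -> exists k, v k = a &
    forall k, v k = a0 -> ev0 (i k) = a0].
  pose v k := List.nth k s a0; have [i [i_fix i_pres]] := ev0_sat v.
  exists v, i; split=> [|a /(@List.In_nth _ s a a0)[k [_ vk]]|k].
  - split=> // [k a b c|k a b c vabc|k]; first exact: (i_pres (inl k)).
      exact/u_pres/(i_pres (inl k)).
    exact: (i_pres (inr true) k k k).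
  - by exists k.
  - exact: (i_pres (inr false) k k k).
pose W n (x y : F n) := exists t, ev0 t = el x /\ w t = el y.
have W0 n : W n 0 0.
  have [v [i [[_ p q _] vP _]]] := tableP [:: el (0 : F n)].
  have [k vk] := vP _ (or_introl erefl).
  by exists (i k); split; [exact: (pres_zero p) | exact: (pres_zero q)].
have WP n a x y x' y' : W n x y -> W n x' y' -> W n (a *: x + x') (a *: y + y').
  move=> [t [tx ty]] [t' [tx' ty']].
  have [v [i [[fixv p q _] vP _]]] :=
    tableP [:: el x; el (a *: x); el x'; el (a *: x + x')].
  have [k1 v1] := vP _ (or_introl erefl).
  have [k2 v2] := vP _ (or_intror (or_introl erefl)).
  have [k3 v3] := vP _ (or_intror (or_intror (or_introl erefl))).
  have [k4 v4] := vP _ (or_intror (or_intror (or_intror (or_introl erefl)))).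
  have p1 : ev0 (i k1) = el x by rewrite fixv v1 //; exists t.
  have p3 : ev0 (i k3) = el x' by rewrite fixv v3 //; exists t'.
  have q1 : w (i k1) = el y by rewrite -ty; apply: (pres_eq u_pres); rewrite p1.
  have q3 : w (i k3) = el y' by rewrite -ty'; apply: (pres_eq u_pres); rewrite p3.
  exists (i k4); split.
  - exact: (pres_add p v2 v3 v4 (pres_scale p v1 v2 p1) p3).
  - exact: (pres_add q v2 v3 v4 (pres_scale q v1 v2 q1) q3).
have Wd n x y : W (n + 1) x y -> W n (df F n x) (df F n y).
  move=> [t [tx ty]].
  have [v [i [[fixv p q _] vP _]]] := tableP [:: el x; el (df F n x)].
  have [k1 v1] := vP _ (or_introl erefl).
  have [k2 v2] := vP _ (or_intror (or_introl erefl)).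
  have p1 : ev0 (i k1) = el x by rewrite fixv v1 //; exists t.
  have q1 : w (i k1) = el y by rewrite -ty; apply: (pres_eq u_pres); rewrite p1.
  exists (i k2); split; first exact: (pres_diff p v1 v2 p1).
  exact: (pres_diff q v1 v2 q1).
pose Pm n z := exists x y, W n x y /\ z = x - y.
have Pm0 n : Pm n 0 by exists 0, 0; rewrite subrr.
have PmP n a z z' : Pm n z -> Pm n z' -> Pm n (a *: z + z').
  move=> [x [y [xy ->]]] [x' [y' [xy' ->]]].
  exists (a *: x + x'), (a *: y + y'); split; first exact: WP.
  by rewrite scalerBr opprD addrACA.
have Pmd n z : Pm (n + 1) z -> Pm n (df F n z).
  by move=> [x [y [/Wd xy ->]]]; rewrite linearB; exists (df F n x), (df F n y).
pose P := @Subcplx R F (fun n => Submod (Pm0 n) (@PmP n)) Pmd.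
exists P; split; last 2 first.
- move=> n z [x [y [[t [tx ty]] ->]]] {z} a az; have e := congr1 (@projT1 _ _) az.
  rewrite /= in e; case: n / e x y tx ty az => x y tx ty /el_inj ->.
  by rewrite linearB (pres_phi u_pres tx ty) subrr.
- have [v [i [[fixv p q _] vP a0i]]] := tableP [:: a0].
  have [k vk] := vP _ (or_introl erefl).
  have ik := a0i _ vk.
  have [n [x def_a0]] : exists n (x : F n), a0 = el x.
    by case: (a0) => n x; exists n, x.
  rewrite def_a0 in vk ik.
  have [y qk] := pres_sort q vk.
  exists n, (x - y); split; first by exists x, y; split=> //; exists (i k).
  move/eqP; rewrite subr_eq0 => /eqP xy; apply: (a0P (u (i k))).
  by rewrite def_a0 xy -[RHS]qk.
(* A table v of elements is sent to N by ev0 \o i, the map called r above, and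
   to D by w \o i, which is theta r. *)
pose good (s : seq (tot F)) (t : forall n, F n -> F n) := exists v i,
  [/\ approx v i, forall a, List.In a s -> exists k, v k = a &
    forall k n (x p q : F n), v k = el x -> ev0 (i k) = el p ->
      w (i k) = el q -> t n x = x - p + q].
have good_ex s : exists t, good s t.
  have [v [i [vi vs _]]] := tableP s; have [_ p q _] := vi.
  have t_ex n (x : F n) : exists y, forall k p q, v k = el x ->
      ev0 (i k) = el p -> w (i k) = el q -> y = x - p + q.
    have [[k vk]|no] := pselect (exists k, v k = el x); last first.
      by exists 0 => k ? ? vk; case: no; exists k.
    have [[a ka] [b kb]] := (pres_sort p vk, pres_sort q vk).
    exists (x - a + b) => k' a' b' vk' ka' kb'.
    have /el_inj -> : el a = el a'.
      by rewrite -ka -ka'; apply: (pres_eq p); rewrite vk vk'.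
    suff /el_inj -> : el b = el b' by [].
    by rewrite -kb -kb'; apply: (pres_eq q); rewrite vk vk'.
  exists (fun n x => projT1 (cid (t_ex n x))), v, i; split=> // k n x.
  by case: cid => y yP a b; exact: yP.
have fact_good f : exists s, forall t, good s t -> respects t f /\
    at_elt (fun n x => P n (x - t n x) /\ (P n x -> t n x = 0)) f.
  case: f => [n x y|n r x|n x|n e].
  - exists [:: el x; el y; el (x + y)] => t [v [i [[_ p q _] vP tP]]]; split=> //=.
    have [k1 v1] := vP _ (or_introl erefl).
    have [k2 v2] := vP _ (or_intror (or_introl erefl)).
    have [k3 v3] := vP _ (or_intror (or_intror (or_introl erefl))).
    have [[a1 p1] [b1 q1]] := (pres_sort p v1, pres_sort q v1).
    have [[a2 p2] [b2 q2]] := (pres_sort p v2, pres_sort q v2).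
    have p3 := pres_add p v1 v2 v3 p1 p2; have q3 := pres_add q v1 v2 v3 q1 q2.
    rewrite (tP _ _ _ _ _ v1 p1 q1) (tP _ _ _ _ _ v2 p2 q2) (tP _ _ _ _ _ v3 p3 q3).
    by rewrite opprD [x + y + _]addrACA [LHS]addrACA.
  - exists [:: el x; el (r *: x)] => t [v [i [[_ p q _] vP tP]]]; split=> //=.
    have [k1 v1] := vP _ (or_introl erefl).
    have [k2 v2] := vP _ (or_intror (or_introl erefl)).
    have [[a1 p1] [b1 q1]] := (pres_sort p v1, pres_sort q v1).
    have p2 := pres_scale p v1 v2 p1; have q2 := pres_scale q v1 v2 q1.
    rewrite (tP _ _ _ _ _ v1 p1 q1) (tP _ _ _ _ _ v2 p2 q2).
    by rewrite scalerDr scalerBr.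
  - exists [:: el x; el (df F n x)] => t [v [i [[_ p q _] vP tP]]]; split=> //=.
    have [k1 v1] := vP _ (or_introl erefl).
    have [k2 v2] := vP _ (or_intror (or_introl erefl)).
    have [[a1 p1] [b1 q1]] := (pres_sort p v1, pres_sort q v1).
    have p2 := pres_diff p v1 v2 p1; have q2 := pres_diff q v1 v2 q1.
    rewrite (tP _ _ _ _ _ v1 p1 q1) (tP _ _ _ _ _ v2 p2 q2).
    by rewrite linearD linearB.
  have elt_good s t : good s t -> List.In (el e) s -> P n (e - t n e).
    move=> [v [i [[_ p q _] vP tP]]] /vP[k vk].
    have [[a pk] [b qk]] := (pres_sort p vk, pres_sort q vk).
    rewrite (tP _ _ _ _ _ vk pk qk) opprD opprB addrA [e + _]addrC subrK.
    by exists a, b; split=> //; exists (i k); split; [exact: pk | exact: qk].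
  (* For e = a - b in P, listing a and b too makes the relation e + b = a
     available. *)
  have [[a [b [[s [sa sb]] def_e]]]|nPe] := pselect (P n e); last first.
    exists [:: el e] => t tgood; split=> //; split=> //.
    exact: elt_good tgood (or_introl erefl).
  exists [:: el e; el b; el a] => t tgood; split=> //.
  split=> [|_]; first exact: elt_good tgood (or_introl erefl).
  have [v [i [[fixv p q Dp] vP tP]]] := tgood.
  have [k1 v1] := vP _ (or_introl erefl).
  have [k2 v2] := vP _ (or_intror (or_introl erefl)).
  have [k3 v3] := vP _ (or_intror (or_intror (or_introl erefl))).
  have p3 : ev0 (i k3) = el a by rewrite fixv v3 //; exists s.
  have q3 : w (i k3) = el b by rewrite -sb; apply: (pres_eq u_pres); rewrite p3.
  have [c p2] := pres_sort p v2.
  have q2 : w (i k2) = el c.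
    by rewrite /w u_fix //; apply: Dp; rewrite v2 -sb; exists (u s).
  have [[a1 p1] [b1 q1]] := (pres_sort p v1, pres_sort q v1).
  have v3' : v k3 = el (e + b) by rewrite v3 def_e subrK.
  have := pres_add p v1 v2 v3' p1 p2; rewrite [LHS]p3 => /el_inj def_a.
  have := pres_add q v1 v2 v3' q1 q2; rewrite [LHS]q3 => /el_inj def_b.
  rewrite (tP _ _ _ _ _ v1 p1 q1) def_e def_a def_b opprD addrACA subrr addr0.
  by rewrite [a1 - b1 - a1]addrAC subrr add0r addNr.
move=> L; suff [s sP] : exists s, forall t, good s t -> forall f, List.In f L ->
    respects t f /\ at_elt (fun n x => P n (x - t n x) /\ (P n x -> t n x = 0)) f.
  by have [t tgood] := good_ex s; exists t; exact: sP.
elim: L => [|f L [s sP]]; first by exists [::].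
have [s' s'P] := fact_good f; exists (s' ++ s) => t [v [i [vi vs tP]]] g [<-|gL].
  by apply: s'P; exists v, i; split=> // a a_s; apply: vs; exact: in_catl.
by apply: sP gL; exists v, i; split=> // a a_s; apply: vs; exact: in_catr.
Qed.

End Small.

Section SmallQuotient.
Variables (R : pzRingType) (M : lmodType R) (n0 : int).

(** If P is maximal and Q = F/P is not named by ev, the nonzero pure subcomplex
    provided by [pure_in_ker] pulls back to a pure subcomplex larger than P. *)
Lemma small_pure_quotient (F : complex R) (phi : {linear F n0 -> M}) : AC_acyclic F ->
  exists (Q : complex R) (p : forall n, {linear F n -> Q n})
      (psi : {linear Q n0 -> M}) (ev : gen_term M -> tot Q),
    [/\ AC_acyclic Q, forall n x, p n (df F n x) = df Q n (p (n + 1) x),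
        forall n q, exists x, p n x = q, forall x, psi (p n0 x) = phi x &
        forall a, exists t, ev t = a].
Proof.
move=> F_ac; have [|P [P_pure P_ker P_max]] := @pure_maximal R F (in_ker phi).
  move=> n u eu; have e := congr1 (@projT1 _ _) eu; rewrite /= in e.
  by case: n / e eu => /el_inj ->; rewrite linear0.
pose Q := quot_cplx P.
have [||psi psiP] := linear_factor_surj (e := qpi P n0) (f := phi).
- exact: qpi_surj.
- by move=> x /qpi_eq0/P_ker/in_ker_at.
have [ev evP] := @saturation (sym M) (aux_term M) (tot Q)
  (el (0 : Q 0)) (rel psi).
exists Q, (@qpi R F P), psi, ev; split.
- exact: AC_acyclic_pure_quotient (@qpi_df R F P) (pure_quot P_pure) F_ac.
- exact: qpi_df.
- exact: qpi_surj.
- exact: psiP.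
apply: contrapT => no; have [||S [S_pure S_ker [n [q [Sq q0]]]]] :=
  @pure_in_ker R M n0 Q psi ev.
- exact: evP.
- have [a aP] : exists a, ~ exists t, ev t = a by exact/existsNP.
  by exists a => t ta; apply: aP; exists t.
have [x def_q] := qpi_surj q; apply: q0; rewrite -def_q; apply/qpi_eq0.
apply: (P_max (preim_subcplx S)) => [||m y Py|].
- exact: pure_preim.
- move=> m y /= Sy u eu; have e := congr1 (@projT1 _ _) eu; rewrite /= in e.
  case: m / e y eu Sy => y /el_inj <- Su; rewrite -psiP; apply/in_ker_at.
  exact: S_ker.
- rewrite /=; have /qpi_eq0 -> := Py; exact: smem0.
- by rewrite /= def_q.
Qed.

(** * Isomorphism types of small complexes *)

Record small := Small {
  small_ob : complex R;
  small_psi : {linear small_ob n0 -> M};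
  small_ev : gen_term M -> tot small_ob;
  small_acyclic : AC_acyclic small_ob;
  small_df : forall x, small_psi (df small_ob n0 x) = 0;
  small_surj : forall a, exists t, small_ev t = a
}.

Definition code := sym M -> gen_term M -> gen_term M -> gen_term M -> Prop.

Definition code_of (s : small) : code :=
  fun k i j l => rel (small_psi s) k (small_ev s i) (small_ev s j) (small_ev s l).

(** Sending the element of s named by a term to the element of s' named by the
    same term is well defined and linear, as these properties can be read off the
    relations between terms. *)
Lemma code_map (s s' : small) : code_of s = code_of s' ->
  exists h : forall n, {linear small_ob s n -> small_ob s' n},
    (forall n x, h n (df _ n x) = df _ n (h (n + 1) x)) /\
    (forall x, small_psi s' (h n0 x) = small_psi s x).
Proof.
move=> ss'.
have pres : preserves (small_psi s) (small_psi s') (small_ev s) (small_ev s').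
  by move=> k i j l; rewrite -[rel (small_psi s) _ _ _ _]/(code_of s k i j l) ss'.
pose W n (x : small_ob s n) (y : small_ob s' n) :=
  exists t, small_ev s t = el x /\ small_ev s' t = el y.
have W_fun n x y y' : @W n x y -> W n x y' -> y = y'.
  move=> [t [tx ty]] [t' [tx' ty']]; apply: el_inj; rewrite -ty -ty'.
  by apply: (pres_eq pres); rewrite tx tx'.
have h_ex n : exists h : {linear small_ob s n -> small_ob s' n}, forall x, W n x (h x).
  apply: linear_graph => [x|a x x' y y' [t [tx ty]] [t' [tx' ty']]|y].
  - have [t tx] := small_surj (el x); have [y ty] := pres_sort pres tx.
    by exists y, t.
  - have [t1 tax] := small_surj (el (a *: x)).
    have [t2 taxx'] := small_surj (el (a *: x + x')).
    exists t2; split=> //; apply: (pres_add pres tax tx' taxx' _ ty').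
    exact: (pres_scale pres tx tax ty).
  - by move=> [t [t0 ty]]; apply: el_inj; rewrite -ty; exact: (pres_zero pres).
pose h n := projT1 (cid (h_ex n)).
have hP n x : W n x (h n x) by rewrite /h; case: cid.
exists h; split=> [n x|x].
- apply: (W_fun _ _ _ _ (hP _ _)).
  have [t [tx ty]] := hP (n + 1) x.
  have [t' tdx] := small_surj (el (df (small_ob s) n x)).
  by exists t'; split=> //; exact: (pres_diff pres tx tdx ty).
- have [t [tx ty]] := hP _ x; exact: (pres_phi pres tx ty).
Qed.

End SmallQuotient.

(** * Cycles in a fixed degree *)

Section Cycles.
Variable R : pzRingType.

Section Shift.
Variables (F : int -> lmodType R) (d : forall n, {linear F (n + 1) -> F n}).

(** The differential between degrees that are consecutive only up to a provable
    equality, as happens after shifting the indices of a complex. *)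
Definition dgen m0 m1 (e : m1 = m0 + 1) : {linear F m1 -> F m0} :=
  eq_rect (m0 + 1) (fun m => {linear F m -> F m0}) (d m0) m1 (esym e).

Lemma dgen_exact m0 m1 m2 (e0 : m1 = m0 + 1) (e1 : m2 = m1 + 1) :
  (forall n, exact_at (d (n + 1)) (d n)) -> exact_at (dgen e1) (dgen e0).
Proof. by move=> d_exact; subst m1 m2; exact: d_exact. Qed.

Lemma dgen_tensor_exact (A : lmodType R^c) m0 m1 m2
    (e0 : m1 = m0 + 1) (e1 : m2 = m1 + 1) :
    (forall n, exact_at (tensor_map (idfun : {linear A -> A}) (d (n + 1)))
                        (tensor_map (idfun : {linear A -> A}) (d n))) ->
  exact_at (tensor_map (idfun : {linear A -> A}) (dgen e1))
           (tensor_map (idfun : {linear A -> A}) (dgen e0)).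
Proof. by move=> d_exact; subst m1 m2; exact: d_exact. Qed.

Lemma dgen_cycle (C : lmodType R) n (i : {linear C -> F (n + 1)}) m0 m1
    (e : m1 = m0 + 1) :
    injective i -> exact_at i (d n) -> m0 = n ->
  exists j : {linear C -> F m1}, injective j /\ exact_at j (dgen e).
Proof. by move=> i_inj i_ex mn; subst m0 m1; exists i. Qed.

End Shift.

Lemma Gorenstein_AC_flat_cycle0 (C : lmodType R) : Gorenstein_AC_flat C ->
  exists F : complex R, AC_acyclic F /\
    exists i : {linear C -> F (0 + 1)}, injective i /\ exact_at i (df F 0).
Proof.
move=> [F [d [F_flat d_exact d_Aexact [n [i [i_inj i_ex]]]]]].
have e k : k + 1 + n = k + n + 1 by rewrite addrAC.
exists (@Complex R (fun k => F (k + n)) (fun k => dgen d (e k))); split.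
  split=> [k|k|A A_clean k]; first exact: F_flat.
  - exact: (dgen_exact (e k) (e (k + 1)) d_exact).
  - exact: (dgen_tensor_exact (e k) (e (k + 1)) (d_Aexact A A_clean)).
by apply: (dgen_cycle _ i_inj i_ex); rewrite add0r.
Qed.

End Cycles.

(** * The precover *)

Section Precover.
Variables (R : pzRingType) (M : lmodType R).

(* Degree 2 makes the cokernel of the incoming differential embed in degree
   0 + 1, so that it is a cycle in degree 0 as it stands. *)
Local Notation n0 := (0 + 1 + 1 : int).

(** Codes form a type in the universe of the modules although the complexes do not,
    so a direct sum over the codes that are realized makes sense. *)
Definition index : Type := {c : code M | exists s : small M n0, code_of s = c}.

Definition realization (c : {classic index}) : small M n0 :=
  projT1 (cid (proj2_sig (c : index))).

Lemma realizationP (s : small M n0) : exists c, code_of (realization c) = code_of s.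
Proof.
pose c : index := exist _ (code_of s) (ex_intro _ s erefl).
by exists c; rewrite /realization; case: cid.
Qed.

Definition big : complex R := dsum_cplx (fun c => small_ob (realization c)).

Definition boundary : submod (big n0).
Proof.
exists (fun y => exists x, df big n0 x = y); first by exists 0; rewrite linear0.
by move=> a _ _ [x <-] [x' <-]; exists (a *: x + x'); rewrite linearP.
Defined.

Definition cover : lmodType R := quot boundary.

Lemma big_acyclic : AC_acyclic big.
Proof. by apply: AC_acyclic_dsum => c; exact: small_acyclic. Qed.

Lemma cover_Gorenstein : Gorenstein_AC_flat cover.
Proof.
have [big_flat big_exact big_Aexact] := big_acyclic.
exists big, (df big); split=> //; exists 0.
have [||i iP] := linear_factor_surj (e := quot_proj boundary) (f := df big (0 + 1)).
- exact: quot_proj_surj.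
- by move=> u /quot_proj_eq0[x <-]; apply/big_exact; exists x.
exists i; split=> [q q'|v].
  have [[u <-] [u' <-]] := (quot_proj_surj q, quot_proj_surj q').
  move=> /eqP; rewrite -subr_eq0 !iP -linearB => /eqP/big_exact[x dx].
  apply/eqP; rewrite -subr_eq0 -linearB; apply/eqP/quot_proj_eq0.
  by exists x.
split=> [/big_exact[u <-]|[q <-]]; first by exists (quot_proj boundary u); rewrite iP.
by have [u <-] := quot_proj_surj q; rewrite iP; apply/big_exact; exists u.
Qed.

(** A cycle C of F in degree 0 is the cokernel of F_3 -> F_2, so psi amounts to a
    map F_2 -> M that kills boundaries.  It factors through a small pure quotient
    of F, hence through the summand of the big complex with the same code, and
    passing to cokernels gives the lift of psi. *)
Lemma cover_lift : exists phi : {linear cover -> M}, forall (C : lmodType R)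
    (psi : {linear C -> M}), Gorenstein_AC_flat C ->
  exists h : {linear C -> cover}, forall u, phi (h u) = psi u.
Proof.
have [Psi PsiP] := dsum_lift (fun c => small_psi (realization c)).
have [||phi phiP] := linear_factor_surj (e := quot_proj boundary) (f := Psi).
- exact: quot_proj_surj.
- move=> _ /quot_proj_eq0[x <-]; have [s sx] := dval_supported x.
  rewrite (dsum_sum (undup_uniq s) (s := undup s) (x := x)); last first.
    by apply: supportedS sx => i; rewrite mem_undup.
  rewrite !linear_sum big1 // => c _.
  by rewrite [X in Psi X]dsum_map_inj PsiP small_df.
exists phi => C psi /Gorenstein_AC_flat_cycle0[F [F_ac [i [i_inj i_ex]]]].
have [_ F_exact _] := F_ac.
have [||e eP] := linear_factor_inj (i := i) (f := df F (0 + 1)) => //.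
  by move=> u; apply/i_ex/F_exact; exists u.
have e_surj m : exists u, e u = m.
  have /F_exact[u du] : df F 0 (i m) = 0 by apply/i_ex; exists m.
  by exists u; apply: i_inj; rewrite eP.
have [Q [p [phiQ [ev [Q_ac pd p_surj phiQP ev_surj]]]]] :=
  small_pure_quotient (psi \o e) F_ac.
have phiQ_df x : phiQ (df Q n0 x) = 0.
  have [y <-] := p_surj _ x; rewrite -pd phiQP /=.
  suff -> : e (df F n0 y) = 0 by rewrite linear0.
  by apply: i_inj; rewrite linear0 eP; apply/F_exact; exists y.
pose s := Small Q_ac phiQ_df ev_surj.
have [c [k [kd kP]]] : exists c
      (k : forall n, {linear Q n -> small_ob (realization c) n}),
    (forall n x, k n (df Q n x) = df _ n (k (n + 1) x)) /\
    (forall x, small_psi (realization c) (k n0 x) = phiQ x).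
  by have [c /esym/code_map] := realizationP s; exists c.
pose inc n : {linear small_ob (realization c) n -> big n} :=
  (dinj (U := fun c => small_ob (realization c) n) (i := c)
    : {linear _ -> dsum (fun c => small_ob (realization c) n)}).
pose H n : {linear F n -> big n} := inc n \o (k n \o p n).
have Hd n x : H n (df F n x) = df big n (H (n + 1) x).
  have := dsum_map_inj (fun c => df (small_ob (realization c)) n) (k _ (p _ x)).
  by rewrite -kd -pd => /esym.
have [||h hP] := linear_factor_surj (e := e) (f := quot_proj boundary \o H n0) => //.
  move=> u e0; have /F_exact[w <-] : df F (0 + 1) u = 0 by rewrite -eP e0 linear0.
  by rewrite [LHS](congr1 _ (Hd _ _)); apply/quot_proj_eq0; exists (H _ w).
exists h => m; have [u <-] := e_surj m; rewrite hP [LHS]phiP.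
by rewrite [LHS]PsiP [LHS]kP [LHS]phiQP.
Qed.

End Precover.

Theorem proposition4p3 (R : pzRingType) : precovering (@Gorenstein_AC_flat R).
Proof.
move=> M; have [phi phiP] := cover_lift M.
by exists (cover M), phi; split=> //; exact: cover_Gorenstein.
Qed.
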